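(* Let $N$ be a feed-forward network with layers $C_0,\dots,C_m$, $f\in\mathcal{V}_0(N)$ generic and $L$ a feed-forward lift of $N$. Denote by $C'_1$ the second layer of $L$ and by $(\sigma^L_i)_{i=1}^k$ the functions representing $L$. Assume that $L$ is the split of a cell $c\in C_1$ into two cells $c_1,c_2\in C'_1$ (and so a lift inside $C_1$). Suppose that for every $I\subseteq C'_1\setminus\{c_1,c_2\}$ there exist $d',d''\in C_2$ such that $$(w_I^{d'}+w_1^{d'})(w_I^{d''}+w_1^{d''})<0\quad\text{and}\quad (w_I^{d'}+w_2^{d'})(w_I^{d''}+w_2^{d''})<0,$$ where, for $d\in C_2$, $$w_I^d=\sum_{i:\,\sigma_i^L(d)\in I} f_i,\qquad w_1^d=\sum_{i:\,\sigma_i^L(d)=c_1} f_i,\qquad w_2^d=\sum_{i:\,\sigma_i^L(d)=c_2} f_i .$$ Then every bifurcation branch of $f$ on $L$ is lifted from $N$.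
   Context: A network $N$ with $k$ edge types is a finite set of cells $C$ together with functions $\sigma_1,\dots,\sigma_k:C\to C$ ($\sigma_i(c)$ is the source of the unique edge of type $i$ targeting $c$); $|N|=|C|$. Networks represented by $(\sigma_i:C\to C)$ and $(\sigma_i':C'\to C')$ are equal if there is a bijection $\varphi:C\to C'$ with $\varphi\circ\sigma_i=\sigma_i'\circ\varphi$ for all $i$. A feed-forward network is a network whose cells can be partitioned into nonempty layers $C_0,\dots,C_m$ (so $C_0$ is the first layer, $C_1$ the second) such that $\sigma_i(c)=c$ for $c\in C_0$ and all $i$; $\sigma_i(C_j)\subseteq C_{j-1}$ for $1\le j\le m$ and all $i$; and for $0\le j\le m-1$ every $c\in C_j$ equals $\sigma_i(c')$ for some $c'\in C_{j+1}$ and some $i$. Feed-forward networks are assumed connected (as undirected graphs). A coloring is an equivalence relation $\bowtie$ on the cells; it is balanced if $c\bowtie c'$ implies $\sigma_i(c)\bowtie\sigma_i(c')$ for all $i$. The quotient network $N/\bowtie$ has the $\bowtie$-classes as cells and is represented by $\sigma_i^{\bowtie}([c]_{\bowtie})=[\sigma_i(c)]_{\bowtie}$. $L$ is a lift of $N$ if $N=L/\bowtie$ for some balanced coloring $\bowtie$ in $L$. $L$ is the split of a cell $c$ of $N$ into cells $c_1,\dots,c_l$ of $L$ if the coloring $\bowtie$ of $L$ whose only non-singleton class is $\{c_1,\dots,c_l\}$ is balanced, $L/\bowtie=N$ and $[c_i]_{\bowtie}=c$. For a feed-forward lift $L$ (layers $C'_0,\dots,C'_n$) of $N$ (layers $C_0,\dots,C_m$),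 $L$ is a lift inside $C_j$ if $m=n$, $|C'_j|\ne|C_j|$ and $|C'_i|=|C_i|$ for $i\ne j$. In the claim, the cells of $L$ other than $c_1,c_2$ are identified with the cells of $N$ other than $c$; in particular the third layer of $L$ is identified with $C_2$. $\mathcal{V}(N)$ is the set of smooth $f:\mathbb{R}\times\mathbb{R}^k\times\mathbb{R}\to\mathbb{R}$, $(x_0,x_1,\dots,x_k,\lambda)\mapsto f$, with $f(0,\dots,0,\lambda)=0$ for all $\lambda$; $f_i=\partial f/\partial x_i$ at the origin. $\mathcal{V}_0(N)=\{f\in\mathcal{V}(N): f_0=0\}$. It depends only on $k$, so $\mathcal{V}_0(N)=\mathcal{V}_0(L)$. The vector field is $(f^N(x,\lambda))_c=f(x_c,x_{\sigma_1(c)},\dots,x_{\sigma_k(c)},\lambda)$ on $\mathbb{R}^{|N|}$. ''Generic'' means: there is an open dense subset $O$ of the space of possible values of the first and second order partial derivatives at the origin of elements of the class, such that the statement holds for every $f$ in the class whose derivatives lie in $O$. A domain is an interval $]-\lambda_0,0]$, $]-\lambda_0,\lambda_0[$ or $[0,\lambda_0[$ with $\lambda_0>0$. An equilibrium branch of $f$ on $N$ is a function $b:D\to\mathbb{R}^{|N|}$ on a domain $D$ with $b(0)=0$ and $f^N(b(\lambda),\lambda)=0$ for all $\lambda\in D$, which is smooth if $D=]-\lambda_0,\lambda_0[$, and continuous on $D$ and smooth on $D\setminus\{0\}$ if $D$ is one-sided. Branches are taken as germs: $b_1:D_1\to\mathbb{R}^{|N|}$ and $b_2:D_2\to\mathbb{R}^{|N|}$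 are related if there is an open neighborhood $U$ of $0$ with $U\cap D_1\cap D_2\ne\{0\}$ and $b_1=b_2$ on $U\cap D_1\cap D_2$; germ equivalence is the transitive closure, and equivalent branches are identified. The bifurcation branches are the equilibrium branches different from the trivial branch $0$. A bifurcation branch $b$ of $f$ on $L$ is lifted from $N$ if there is a balanced coloring $\bowtie$ in $L$ with $N=L/\bowtie$ and $b\in\Delta_{\bowtie}$, i.e. $b(\lambda)\in\Delta_{\bowtie}=\{x: c\bowtie d\Rightarrow x_c=x_d\}$ for all $\lambda$ in the domain near $0$. *)

(* Defs.v *)
From HB Require Import structures.
From mathcomp Require Import all_boot all_order all_algebra generic_quotient.
From mathcomp Require Import all_classical all_reals all_analysis.
From Stdlib Require Import Relation_Operators.

Set Implicit Arguments.
Unset Strict Implicit.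
Unset Printing Implicit Defensive.

Import Order.TTheory GRing.Theory Num.Theory.
Import numFieldNormedType.Exports.

Local Open Scope quotient_scope.
Local Open Scope classical_set_scope.
Local Open Scope ring_scope.

(* [src i c] is sigma_i(c), the source of the edge of type i targeting c. *)
Record network (k : nat) := Network {
  cell :> finType;
  src : 'I_k -> cell -> cell
}.
Arguments src {k} n i c.

Definition network_iso k (N M : network k) (phi : N -> M) : Prop :=
  bijective phi /\ forall i c, phi (src N i c) = src M i (phi c).

(* The convention is that isomorphic networks are equal. *)
Definition network_eq k (N M : network k) : Prop :=
  exists phi : N -> M, network_iso phi.

Definition adjacent k (N : network k) : rel N :=
  fun c d => [exists i, (src N i c == d) || (src N i d == c)].

Definition connected_network k (N : network k) : Prop :=
  forall c d : N, connect (@adjacent k N) c d.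

(* A partition of the cells into layers C_0, ..., C_m is encoded by the map
   [lay] sending a cell to the index of its layer. *)
Definition layer k (N : network k) (lay : N -> nat) (j : nat) : {set N} :=
  [set c | lay c == j].

Record feed_forward k (N : network k) (m : nat) (lay : N -> nat) : Prop := {
  ff_connected : connected_network N;
  ff_cover : forall c, (lay c <= m)%N;
  ff_nonempty : forall j, (j <= m)%N -> exists c, c \in layer lay j;
  ff_first : forall i c, c \in layer lay 0 -> src N i c = c;
  ff_prev : forall j i c, (j < m)%N ->
    c \in layer lay j.+1 -> src N i c \in layer lay j;
  ff_next : forall j c, (j < m)%N -> c \in layer lay j ->
    exists i c', c' \in layer lay j.+1 /\ c = src N i c'
}.

Definition balanced k (N : network k) (e : equiv_rel N) : Prop :=
  forall i c d, e c d -> e (src N i c) (src N i d).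

(* The finite counterpart of the instance for countable types given with
   {eq_quot _} in the library. *)
HB.instance Definition _ (D : Type) (C : finType) (CD : C -> D) (DC : D -> C)
    (eD : equiv_rel D) (encD : encModRel CD DC eD) :=
  Finite.copy {eq_quot encD} (can_type (EquivQuot.ereprK (encD := encD))).

(* [lift_op1] applies [src i] to a representative of the class, so this is the
   quotient network only for a balanced [e]. *)
Definition quotient_network k (N : network k) (e : equiv_rel N) : network k :=
  @Network k {eq_quot e} (fun i => lift_op1 {eq_quot e} (src N i)).

Definition cell_class k (N : network k) (e : equiv_rel N) (c : N) :
  quotient_network e := \pi_{eq_quot e} c.

Definition is_lift k (N L : network k) : Prop :=
  exists2 e : equiv_rel L, balanced e & network_eq (quotient_network e) N.

Definition collapse_rel (T : finType) (S : {set T}) : rel T :=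
  fun c d => (c == d) || (c \in S) && (d \in S).

Lemma collapse_refl (T : finType) (S : {set T}) : reflexive (collapse_rel S).
Proof. by move=> c; rewrite /collapse_rel eqxx. Qed.

Lemma collapse_sym (T : finType) (S : {set T}) : symmetric (collapse_rel S).
Proof. by move=> c d; rewrite /collapse_rel eq_sym andbC. Qed.

Lemma collapse_trans (T : finType) (S : {set T}) : transitive (collapse_rel S).
Proof.
move=> d c a; rewrite /collapse_rel => /orP[/eqP->//|/andP[cS dS]].
by move=> /orP[/eqP<-|/andP[_ ->]]; rewrite cS ?dS ?orbT.
Qed.

(* The equivalence relation whose only non-singleton class is S (for a set S
   with at least two elements). *)
Definition collapse (T : finType) (S : {set T}) : equiv_rel T :=
  EquivRel (collapse_rel S) (@collapse_refl T S) (@collapse_sym T S) (@collapse_trans T S).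

(* L is the split of the cell c of N into the cells of S.  The isomorphism
   [phi] realizing the equality of L / collapse S and N is a parameter because it
   identifies the cells of L outside S with the cells of N other than c. *)
Record is_split k (N L : network k) (c : N) (S : {set L})
    (phi : quotient_network (collapse S) -> N) : Prop := {
  split_card : (1 < #|S|)%N;
  split_balanced : balanced (collapse S);
  split_iso : network_iso phi;
  split_class : forall d, d \in S -> phi (cell_class (collapse S) d) = c
}.

Section Smooth.
Variables (R : realType) (n : nat).
Implicit Type f : 'rV[R]_n -> R.

Definition partial (j : 'I_n) f : 'rV[R]_n -> R :=
  fun x => 'D_(delta_mx 0 j) f x.

(* Differentiable partial derivatives of every order, i.e. C^oo: each of them
   is in particular continuous. *)
Definition smooth f : Prop :=
  forall (s : seq 'I_n) (x : 'rV[R]_n), differentiable (foldr partial f s) x.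

Definition jet2 f : 'rV[R]_n * 'M[R]_n :=
  (\row_a partial a f 0, \matrix_(a, b) partial a (partial b f) 0).

(* O is open and dense in the space of possible values of [jet2] on the class
   F, for the topology induced by the one of 'rV_n * 'M_n. *)
Definition generic (F : set ('rV[R]_n -> R)) (P : ('rV[R]_n -> R) -> Prop) :=
  exists O : set ('rV[R]_n * 'M[R]_n),
    [/\ exists2 U : set ('rV[R]_n * 'M[R]_n), open U & O = U `&` (jet2 @` F),
        jet2 @` F `<=` closure O
      & forall f, F f -> O (jet2 f) -> P f].

End Smooth.

Section VectorField.
Variables (R : realType) (k : nat).
Implicit Type f : 'rV[R]_(1 + k + 1) -> R.

(* The argument (x_0, x_1, ..., x_k, lambda) of f, and the positions of x_0
   and of x_1, ..., x_k in it. *)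
Definition args (x0 : R) (x : 'I_k -> R) (l : R) : 'rV[R]_(1 + k + 1) :=
  row_mx (row_mx x0%:M (\row_i x i)) l%:M.

Definition pos0 : 'I_(1 + k + 1) := lshift 1 (lshift k ord0).
Definition pos (i : 'I_k) : 'I_(1 + k + 1) := lshift 1 (rshift 1 i).

Definition V : set ('rV[R]_(1 + k + 1) -> R) :=
  [set f | smooth f /\ forall l, f (args 0 (fun=> 0) l) = 0].

Definition V0 : set ('rV[R]_(1 + k + 1) -> R) :=
  [set f | V f /\ partial pos0 f 0 = 0].

Definition vector_field f (N : network k) (x : N -> R) (l : R) : N -> R :=
  fun c => f (args (x c) (fun i => x (src N i c)) l).

Definition weight f (N : network k) (I : {set N}) (d : N) : R :=
  \sum_(i | src N i d \in I) partial (pos i) f 0.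

End VectorField.

Arguments V R k : clear implicits.
Arguments V0 R k : clear implicits.

Section Branches.
Variable R : realType.

(* Smoothness on an open set A; the values of g outside A are irrelevant. *)
Definition smooth_on (A : set R) (g : R -> R) : Prop :=
  forall n l, A l -> derivable (derive1n n g) l 1.

Definition two_sided (D : set R) : Prop :=
  exists2 l0 : R, 0 < l0 & D = `]- l0, l0[%classic.

Definition one_sided (D : set R) : Prop :=
  exists2 l0 : R, 0 < l0 & D = `]- l0, 0]%classic \/ D = `[0, l0[%classic.

Definition regular_on (D : set R) (g : R -> R) : Prop :=
  (two_sided D -> smooth_on D g) /\
  (one_sided D -> {within D, continuous g} /\ smooth_on (D `\ 0) g).

(* A branch is a function on [br_dom]; the values of [br_fun] elsewhere are
   irrelevant. *)
Record branch k (f : 'rV[R]_(1 + k + 1) -> R) (N : network k) := Branch {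
  br_dom : set R;
  br_fun : R -> N -> R;
  br_domain : two_sided br_dom \/ one_sided br_dom;
  br_regular : forall c, regular_on br_dom (fun l => br_fun l c);
  br_origin : forall c, br_fun 0 c = 0;
  br_equilibrium : forall l, br_dom l ->
    forall c, vector_field f (br_fun l) l c = 0
}.

Section Germs.
Variables (k : nat) (f : 'rV[R]_(1 + k + 1) -> R) (N : network k).
Implicit Type b : branch f N.

Definition germ_related b1 b2 : Prop :=
  exists U : set R,
    [/\ open U, U 0, U `&` br_dom b1 `&` br_dom b2 <> [set 0]
      & forall l, (U `&` br_dom b1 `&` br_dom b2) l ->
          br_fun b1 l =1 br_fun b2 l].

Definition germ_equiv : branch f N -> branch f N -> Prop :=
  clos_trans _ germ_related.

Definition zero_branch b : Prop :=
  forall l, br_dom b l -> forall c, br_fun b l c = 0.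

Definition bifurcation_branch b : Prop :=
  ~ exists b0, zero_branch b0 /\ germ_equiv b b0.

End Germs.

Definition polydiagonal k (N : network k) (e : equiv_rel N) : set (N -> R) :=
  [set x | forall c d, e c d -> x c = x d].

Definition lifted_from k (f : 'rV[R]_(1 + k + 1) -> R) (N L : network k)
    (b : branch f L) : Prop :=
  exists e : equiv_rel L,
    [/\ balanced e, network_eq (quotient_network e) N
      & \forall l \near (0 : R), br_dom b l -> polydiagonal e (br_fun b l)].

End Branches.

(* Main.v *)
(* Near a branch, the equilibrium equations are solved layer by layer, for each
   small value of lambda separately.  For generic f in V_0 we have
   f_1 + ... + f_k <> 0 and f_00 <> 0.  The first condition forces the cells of
   the first layer to vanish.  A cell of the second layer then solves
   f(x, 0, ..., 0, lambda) = 0; since f_00 <> 0 this equation has at most one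
   small nonzero root x, so every cell of the second layer is 0 or x.  For a cell
   d of the third layer, with y its value and W the sum of the f_i over the edges
   coming from cells with value x, the interpolation error formula
   f(y, 0, ..., 0, lambda) = y (y - x) f_00(...) / 2 gives
     y^2 (f_00 / 2 + o(1)) + x (W + o(1)) = 0,
   hence f_00 x W < 0 if W <> 0.  If c_1 and c_2 have different values, exactly
   one of them is x, and the cells d' and d'' given by the hypothesis, for I the
   set of the other second-layer cells with value x, have sums W of opposite
   signs: contradiction. *)
From HB Require Import structures.
Require Import Defs.
From mathcomp Require Import all_boot all_order all_algebra generic_quotient.
From mathcomp Require Import all_classical all_reals all_analysis.
From mathcomp Require Import ring lra.

Set Implicit Arguments.
Unset Strict Implicit.
Unset Printing Implicit Defensive.

Import Order.TTheory GRing.Theory Num.Theory.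
Import numFieldNormedType.Exports.
Local Open Scope classical_set_scope.
Local Open Scope ring_scope.

(** * Rolle's theorem and the error of linear interpolation *)

Lemma is_derive_continuous_within (R : realType) (g g1 : R -> R) (A : set R) :
  (forall t : R, is_derive t 1 g (g1 t)) -> {within A, continuous g}.
Proof.
move=> dg; apply: continuous_subspaceT => t; apply: differentiable_continuous.
by apply/derivable1_diffP; case: (dg t).
Qed.

Lemma exists_derive_eq0 (R : realType) (g g1 : R -> R) (a b : R) :
  (forall t : R, is_derive t 1 g (g1 t)) -> a < b -> g a = g b ->
  exists2 t, a < t < b & g1 t = 0.
Proof.
move=> dg ab gab.
have dg' t : t \in `]a, b[ -> derivable g t 1 by case: (dg t).
have [t tab tg] := Rolle ab dg' (is_derive_continuous_within dg) gab.
by exists t; [rewrite in_itv in tab | case: (dg t) => _ <-; case: tg].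
Qed.

Lemma exists_derive2_eq0 (R : realType) (g g1 g2 : R -> R) (a b c : R) :
  (forall t : R, is_derive t 1 g (g1 t)) -> (forall t : R, is_derive t 1 g1 (g2 t)) ->
  a < b < c -> g a = 0 -> g b = 0 -> g c = 0 ->
  exists2 t, a < t < c & g2 t = 0.
Proof.
move=> dg dg1 /andP[ab bc] ga gb gc.
have [|s /andP[as_ sb] g1s] := @exists_derive_eq0 _ _ _ _ _ dg ab.
  by rewrite ga.
have [|t /andP[bt tc] g1t] := @exists_derive_eq0 _ _ _ _ _ dg bc.
  by rewrite gb.
have [|r /andP[sr rt] g2r] := @exists_derive_eq0 _ _ _ _ _ dg1 (lt_trans sb bt).
  by rewrite g1s.
by exists r => //; rewrite (lt_trans as_) ?(lt_trans rt).
Qed.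

(** With [K] chosen so that [g t - K t (t - x)] vanishes at [y] as well as at 0 and [x], Rolle's
    theorem up to second order gives a zero [t] of [g2 - 2 K] between the outermost of these points.
    The bound [d] confines [t] whatever the order of the points. *)
Lemma interpolation_error (R : realType) (g g1 g2 : R -> R) (x y d : R) :
  (forall t : R, is_derive t 1 g (g1 t)) -> (forall t : R, is_derive t 1 g1 (g2 t)) ->
  g 0 = 0 -> g x = 0 -> x != 0 -> `|x| < d -> `|y| < d ->
  exists2 t, `|t| < d & g y = y * (y - x) * (g2 t / 2).
Proof.
move=> dg dg1 g0 gx x0 xd yd.
have d0 : 0 < d by apply: le_lt_trans xd.
(* At the nodes 0 and [x] both sides vanish for every [t], while [K] would be a division by 0. *)
have [->|y0] := eqVneq y 0; first by exists 0; rewrite ?normr0// g0 !mul0r.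
have [->|yx] := eqVneq y x; first by exists 0; rewrite ?normr0// gx subrr mulr0 mul0r.
pose K := g y / (y * (y - x)).
have yyx : y * (y - x) != 0 by rewrite mulf_neq0// subr_eq0.
pose h (t : R) := g t - K * (t * (t - x)).
pose h1 (t : R) := g1 t - K * (2 * t - x).
pose h2 (t : R) := g2 t - K * 2.
have dh (t : R) : is_derive t 1 h (h1 t).
  have -> : h = g - K *: (id * (id - cst x)) by [].
  apply: is_derive_eq; rewrite /h1 /GRing.scale/= subr0 !mulr1.
  by rewrite -[(id - cst x) t]/(t - x); ring.
have dh1 (t : R) : is_derive t 1 h1 (h2 t).
  have -> : h1 = g1 - K *: (2 *: id - cst x) by [].
  by apply: is_derive_eq; rewrite /h2 /GRing.scale/= subr0 mulr1.
have h0 : h 0 = 0 by rewrite /h g0 mul0r mulr0 subrr.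
have hx : h x = 0 by rewrite /h gx subrr !mulr0 subrr.
have hy : h y = 0 by rewrite /h /K divfK// subrr.
suff [t td h2t] : exists2 t, `|t| < d & h2 t = 0.
  exists t => //; move/eqP: h2t; rewrite subr_eq0 => /eqP->.
  by rewrite mulfK ?pnatr_eq0// mulrC /K divfK.
have key a b c : `|a| < d -> `|c| < d -> h a = 0 -> h b = 0 -> h c = 0 ->
    a < b -> b < c -> exists2 t, `|t| < d & h2 t = 0.
  move=> + + ha hb hc ab bc; rewrite !ltr_norml => /andP[ad _] /andP[_ cd].
  have abc : a < b < c by rewrite ab.
  have [t /andP[at_ tc] h2t] := @exists_derive2_eq0 _ _ _ _ _ _ _ dh dh1 abc ha hb hc.
  by exists t => //; rewrite ltr_norml (lt_trans ad) ?(lt_trans tc).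
have d0' : `|0 : R| < d by rewrite normr0.
(* Each of the six orders of 0, [x], [y] is an instance of [key]; [lra] discards the inconsistent
   combinations. *)
move: x0 y0 yx; rewrite !neq_lt => /orP[] x0 /orP[] y0 /orP[] yx;
  first [exact: (key x y 0) | exact: (key y x 0) | exact: (key 0 x y) | exact: (key 0 y x)
   | exact: (key x 0 y) | exact: (key y 0 x) | lra].
Qed.

(** * Derivatives along lines, and the coordinates of [args] *)

(** The difference quotient in [s] at [t] is that of [f] at [p + t *: v] in the direction [v]; the
    differential there is expanded in the standard basis. *)
Lemma is_derive_line (R : realType) n (f : 'rV[R]_n -> R) (p v : 'rV[R]_n) (t : R) :
  differentiable f (p + t *: v) ->
  is_derive t 1 (fun s => f (p + s *: v))
    (\sum_a v 0 a * partial a f (p + t *: v)).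
Proof.
move=> df.
have E : (fun h : R => h^-1 *: (f (p + (h *: (1 : R) + t) *: v) - f (p + t *: v))) =
    (fun h => h^-1 *: (f (h *: v + (p + t *: v)) - f (p + t *: v))).
  by apply/funext => h; rewrite scalerDl addrCA /GRing.scale/= mulr1.
have dv : derivable f (p + t *: v) v by exact: diff_derivable.
split; first by rewrite /derivable/= E.
rewrite /derive/= E -[LHS]/('D_v f _); set p' := p + t *: v in df *.
rewrite deriveE// [in LHS](row_sum_delta v) linear_sum.
by apply: eq_bigr => a _; rewrite linearZ/= /partial deriveE.
Qed.

Section Args.
Variables (R : realType) (k : nat).
Implicit Type f : 'rV[R]_(1 + k + 1) -> R.

Lemma sum_pos (F : 'I_(1 + k + 1) -> R) :
  \sum_a F a = F (pos0 k) + \sum_i F (pos i) + F (rshift (1 + k) 0).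
Proof. by rewrite big_split_ord/= big_split_ord/= !big_ord1. Qed.

Lemma args_pos0 (y l : R) (x : 'I_k -> R) : args y x l 0 (pos0 k) = y.
Proof. by rewrite /args /pos0 row_mxEl row_mxEl mxE eqxx. Qed.

Lemma args_pos (y l : R) (x : 'I_k -> R) i : args y x l 0 (pos i) = x i.
Proof. by rewrite /args /pos row_mxEl row_mxEr mxE. Qed.

Lemma args_last (y l : R) (x : 'I_k -> R) : args y x l 0 (rshift (1 + k) 0) = l.
Proof. by rewrite /args row_mxEr mxE eqxx. Qed.

Lemma args_line (y b t l : R) (x u : 'I_k -> R) :
  args (y + t * b) (fun i => x i + t * u i) l = args y x l + t *: args b u 0.
Proof.
by apply/rowP => a; rewrite !mxE; case: splitP => a'; rewrite !mxE;
  [case: splitP => a'' _; rewrite !mxE ?ord1 ?eqxx ?mulr1n|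
   rewrite ord1 eqxx !mulr1n mulr0 addr0].
Qed.

Lemma is_derive_args f (y b t l : R) (x u : 'I_k -> R) :
  (forall z, differentiable f z) ->
  is_derive t 1 (fun s => f (args (y + s * b) (fun i => x i + s * u i) l))
    (b * partial (pos0 k) f (args (y + t * b) (fun i => x i + t * u i) l) +
     \sum_i u i * partial (pos i) f (args (y + t * b) (fun i => x i + t * u i) l)).
Proof.
move=> df; under eq_fun do rewrite args_line.
rewrite args_line; apply: is_derive_eq.
  by apply: is_derive_line; apply: df.
(* The direction has 0 in the lambda slot, so the partial derivative in lambda drops out. *)
rewrite sum_pos args_pos0 args_last mul0r addr0; congr (_ + _).
by apply: eq_bigr => i _; rewrite args_pos.
Qed.

Lemma is_derive_args0 f (t l : R) :
  (forall z, differentiable f z) ->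
  is_derive t 1 (fun s => f (args s (fun=> 0) l)) (partial (pos0 k) f (args t (fun=> 0) l)).
Proof.
move=> df; have := @is_derive_args f 0 1 t l (fun=> 0) (fun=> 0) df.
rewrite big1 ?addr0 => [|i _]; last by rewrite mul0r.
by under eq_fun do rewrite add0r mulr1 mulr0 addr0; rewrite add0r mulr1 mulr0 addr0 mul1r.
Qed.

(** Balls of row vectors are defined entrywise, so a neighbourhood of the origin contains a cube in
    the coordinates. *)
Lemma near0_args (P : set 'rV[R]_(1 + k + 1)) :
  (\forall z \near (0 : 'rV[R]_(1 + k + 1)), P z) ->
  exists2 d : R, 0 < d & forall y x l, `|y| < d -> (forall i, `|x i| < d) ->
    `|l| < d -> P (args y x l).
Proof.
move=> /nbhs_ballP[d /= d0 dP]; exists d => // y x l yd xd ld; apply: dP.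
split=> // i j; rewrite /ball/= !mxE sub0r normrN.
by case: splitP => a; rewrite !mxE; [case: splitP => a' _; rewrite !mxE|];
  rewrite ?ord1 ?eqxx ?mulr1n.
Qed.

End Args.

(** * Limits of finite sums, and the sign computation in abstract form *)

Lemma cvg_sumr (R : realType) (T I : Type) (F : set_system T) {FF : Filter F}
    (r : seq I) (P : pred I) (u : I -> T -> R) (l : I -> R) :
  (forall i, P i -> u i x @[x --> F] --> l i) ->
  \sum_(i <- r | P i) u i x @[x --> F] --> \sum_(i <- r | P i) l i.
Proof.
by move=> ul; apply: (cvg_big (@pseudometric_normed_Zmodule.add_continuous _ _)).
Qed.

(** Here [a] and [c] stand for [f00] and a weight at the origin, [h] and [g] for their values
    nearby. By [E], [h (x g - x y h / 2) = - (y h)^2 / 2]: the correction [y h / 2] absorbs the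
    mixed product. If [a x c] were nonnegative, its product with this would be nonpositive, but that
    product is [(a h) (c (g - y h / 2)) x^2 > 0]. *)
Lemma forced_sign_algebra (R : realFieldType) (a c g h x y : R) :
  x != 0 -> - (y * (y - x) * (h / 2)) = x * g -> 0 < a * h ->
  0 < c * (g - y * (h / 2)) -> a * x * c < 0.
Proof.
move=> x0 E ah cg; rewrite ltNge; apply/negP => axc.
have : 0 < (a * h) * (c * (g - y * (h / 2))) * x ^+ 2.
  by apply: mulr_gt0; [exact: mulr_gt0 | rewrite exprn_even_gt0].
apply/negP; rewrite -leNgt.
have -> : (a * h) * (c * (g - y * (h / 2))) * x ^+ 2 =
    (a * x * c) * (h * (x * g - x * y * (h / 2))) by ring.
rewrite -E mulr_ge0_le0//.
have -> : h * (- (y * (y - x) * (h / 2)) - x * y * (h / 2)) = - ((y * h) ^+ 2 / 2).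
  by field.
by rewrite oppr_le0 divr_ge0 ?sqr_ge0.
Qed.

(** * Uniform estimates for the equilibrium equations near the origin *)

Section Estimates.
Variables (R : realType) (k : nat) (f : 'rV[R]_(1 + k + 1) -> R).
Hypothesis Vf : V R k f.

Let f0 := partial (pos0 k) f.
Let f00 := partial (pos0 k) f0.
Let w (S : {set 'I_k}) z := \sum_(i in S) partial (pos i) f z.

Let df z : differentiable f z. Proof. by case: Vf => /(_ [::]). Qed.
Let dpartial a z : differentiable (partial a f) z.
Proof. by case: Vf => /(_ [:: a]). Qed.
Let df00 z : differentiable f00 z.
Proof. by case: Vf => /(_ [:: pos0 k; pos0 k]). Qed.

(** On the segment from 0 to [y] along the diagonal, [f] vanishes at both ends; by Rolle's theorem
    its derivative, [y] times the sum assumed nonzero, vanishes in between. *)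
Lemma diagonal_root_eq0 (d : R) :
  (forall y x l, `|y| < d -> (forall i, `|x i| < d) -> `|l| < d ->
    f0 (args y x l) + \sum_i partial (pos i) f (args y x l) != 0) ->
  forall y l, `|y| < d -> `|l| < d -> f (args y (fun=> y) l) = 0 -> y = 0.
Proof.
move=> dP y l yd ld fy; apply/eqP; apply: contraT => y0.
have d0 : 0 < d by apply: le_lt_trans ld.
pose g (s : R) := f (args (0 + s * y) (fun=> 0 + s * y) l).
have g01 : g 0 = g 1 by rewrite /g !mul0r !mul1r !add0r fy; case: Vf.
have [t /andP[t0 t1]] := @exists_derive_eq0 _ g _ 0 1
  (fun t => @is_derive_args R k f 0 y t l (fun=> 0) (fun=> y) df) ltr01 g01.
have td : `|0 + t * y| < d.
  by rewrite add0r normrM (le_lt_trans _ yd)// ler_piMl// ltW// gtr0_norm.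
rewrite -mulr_sumr -mulrDr => /eqP; rewrite mulf_eq0 (negbTE y0)/=.
by rewrite (negbTE (dP _ _ _ td (fun=> td) ld)).
Qed.

Lemma root_interpolation (d l x y : R) :
  f (args x (fun=> 0) l) = 0 -> x != 0 -> `|x| < d -> `|y| < d ->
  exists2 t, `|t| < d &
    f (args y (fun=> 0) l) = y * (y - x) * (f00 (args t (fun=> 0) l) / 2).
Proof.
move=> fx x0 xd yd.
have dg (t : R) := @is_derive_args0 R k f t l df.
have dg1 (t : R) := @is_derive_args0 R k f0 t l (dpartial _).
have g0 : f (args 0 (fun=> 0) l) = 0 by case: Vf => _; exact.
exact: interpolation_error dg dg1 g0 fx x0 xd yd.
Qed.

(** Interpolation at the roots 0 and [x], evaluated at the root [y], leaves [y (y - x) f00 = 0] with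
    [f00] nonzero. *)
Lemma nonzero_root_unique (d : R) :
  (forall y x l, `|y| < d -> (forall i, `|x i| < d) -> `|l| < d ->
    0 < f00 0 * f00 (args y x l)) ->
  forall x y l, `|x| < d -> `|y| < d -> `|l| < d -> x != 0 -> y != 0 ->
    f (args x (fun=> 0) l) = 0 -> f (args y (fun=> 0) l) = 0 -> x = y.
Proof.
move=> dP x y l xd yd ld x0 y0 fx fy.
have d0 : 0 < d by apply: le_lt_trans ld.
have [t td /eqP] := @root_interpolation d l x y fx x0 xd yd.
rewrite fy eq_sym !mulf_eq0 (negbTE y0) invr_eq0 pnatr_eq0 orbF/= => /orP[|/eqP f00t].
  by rewrite subr_eq0 => /eqP.
have := dP t (fun=> 0) l td; rewrite normr0 f00t mulr0 ltxx.
by move=> /(_ (fun=> d0) ld).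
Qed.

(** Switching on the inputs in [S] changes [f] by [x * w S z] for some [z], by the mean value
    theorem, and this must cancel the interpolated [y (y - x) f00 z' / 2]. Since [z] and [z'] are
    unrelated, the second bound is assumed at two independent points. *)
Lemma forced_root_sign (S : {set 'I_k}) (d : R) :
  (forall y x l, `|y| < d -> (forall i, `|x i| < d) -> `|l| < d ->
    0 < f00 0 * f00 (args y x l)) ->
  (forall y x l y' x' l', `|y| < d -> (forall i, `|x i| < d) -> `|l| < d ->
     `|y'| < d -> (forall i, `|x' i| < d) -> `|l'| < d ->
    0 < w S 0 * (w S (args y x l) - y * (f00 (args y' x' l') / 2))) ->
  forall x y l, `|x| < d -> `|y| < d -> `|l| < d -> x != 0 ->
    f (args x (fun=> 0) l) = 0 -> f (args y (fun i => if i \in S then x else 0) l) = 0 ->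
    f00 0 * x * w S 0 < 0.
Proof.
move=> dP dQ x y l xd yd ld x0 fx fy.
have d0 : 0 < d by apply: le_lt_trans ld.
have [t td fy0] := @root_interpolation d l x y fx x0 xd yd.
pose u i : R := if i \in S then x else 0.
pose g (s : R) := f (args (y + s * 0) (fun i => 0 + s * u i) l).
have dg (t : R) := @is_derive_args R k f y 0 t l (fun=> 0) u df.
have g1 : g 1 = 0.
  rewrite -fy; congr (f (args _ _ _)); first by rewrite mulr0 addr0.
  by apply/funext => i; rewrite mul1r add0r.
have g0 : g 0 = f (args y (fun=> 0) l).
  congr (f (args _ _ _)); first by rewrite mulr0 addr0.
  by apply/funext => i; rewrite mul0r addr0.
have [s] := MVT ltr01 (fun t _ => dg t) (is_derive_continuous_within dg).
rewrite in_itv/= => /andP[s0 s1]; rewrite -/(g 1) -/(g 0) g1 g0 subr0 mulr1 mul0r add0r.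
set z := args (y + _) _ _; set z' := args t _ _ in fy0.
have -> : \sum_i u i * partial (pos i) f z = x * w S z.
  rewrite mulr_sumr [RHS]big_mkcond; apply: eq_bigr => i _.
  by rewrite /u; case: ifP; rewrite ?mul0r.
rewrite fy0 add0r => E.
have zd i : `|0 + s * u i| < d.
  rewrite add0r normrM /u; case: ifP => _; last by rewrite normr0 mulr0.
  by rewrite (le_lt_trans _ xd)// ler_piMl// ltW// gtr0_norm.
have yd' : `|y + s * 0| < d by rewrite mulr0 addr0.
have td' (i : 'I_k) : `|0 : R| < d by rewrite normr0.
have := dQ _ _ l t _ l yd' zd ld td td' ld.
have := dP t _ l td td' ld.
rewrite -/z -/z' mulr0 addr0.
move: (f00 0) (f00 z') (w S 0) (w S z) E => a h c g' E ah cg.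
exact: forced_sign_algebra x0 E ah cg.
Qed.

(** Each condition is open and holds at the origin, where the last product is [(w S 0)^2];
    continuity does the rest. *)
Lemma near_uniform_bounds :
  f0 0 + \sum_i partial (pos i) f 0 != 0 -> f00 0 != 0 ->
  exists2 d : R, 0 < d &
  [/\ forall y x l, `|y| < d -> (forall i, `|x i| < d) -> `|l| < d ->
        f0 (args y x l) + \sum_i partial (pos i) f (args y x l) != 0,
      forall y x l, `|y| < d -> (forall i, `|x i| < d) -> `|l| < d ->
        0 < f00 0 * f00 (args y x l) &
      forall S, w S 0 != 0 -> forall y x l y' x' l',
        `|y| < d -> (forall i, `|x i| < d) -> `|l| < d ->
        `|y'| < d -> (forall i, `|x' i| < d) -> `|l'| < d ->
        0 < w S 0 * (w S (args y x l) - y * (f00 (args y' x' l') / 2))].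
Proof.
move=> T0 A0.
(* An abstract filter [F], as unification would unfold the matrix topology. *)
have [F FF FE] : exists2 F, Filter F & F = nbhs (0 : 'rV[R]_(1 + k + 1)).
  by exists (nbhs (0 : 'rV[R]_(1 + k + 1))); first exact: nbhs_filter.
have cpartial a : partial a f z @[z --> F] --> partial a f 0.
  by rewrite FE; apply: differentiable_continuous; exact: dpartial.
have cf00 : f00 z @[z --> F] --> f00 0.
  by rewrite FE; apply: differentiable_continuous; exact: df00.
have cpos0 : (fun z : 'rV[R]_(1 + k + 1) => z 0 (pos0 k)) @ F --> (0 : R).
  rewrite FE; have := @coord_continuous R _ _ 0 (pos0 k) (0 : 'rV[R]_(1 + k + 1)).
  by rewrite /continuous_at mxE.
have cw S : w S z @[z --> F] --> w S 0.
  by apply: cvg_sumr => i _; exact: cpartial.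
have P1 : \forall z \near F, f0 z + \sum_i partial (pos i) f z != 0.
  apply: cvgr_neq0 T0; apply: cvgD; first exact: cpartial.
  by apply: cvg_sumr => i _; exact: cpartial.
have P2 : \forall z \near F, 0 < f00 0 * f00 z.
  apply: (cvgr_gt (f00 0 * f00 0)); first exact: cvgMl_tmp.
  by rewrite -expr2 exprn_even_gt0.
(* Two independent points call for the product filter; since there are finitely many [S], one
   neighbourhood serves them all. *)
have P3 : \forall p \near (F, F), forall S, w S 0 != 0 ->
    0 < w S 0 * (w S p.1 - p.1 0 (pos0 k) * (f00 p.2 / 2)).
  apply: (@filter_forall _ _ _ (filter_prod F F)) => S.
  have [->|wS] := eqVneq (w S 0) 0; first exact: nearW.
  have cS : w S 0 * (w S p.1 - p.1 0 (pos0 k) * (f00 p.2 / 2)) @[p --> (F, F)] -->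
      w S 0 * (w S 0 - 0 * (f00 0 / 2)).
    apply: cvgMl_tmp; apply: cvgB; first by apply: cvg_comp (cw S); exact: cvg_fst.
    apply: cvgM; first by apply: cvg_comp cpos0; exact: cvg_fst.
    by apply: cvgMr_tmp; apply: cvg_comp cf00; exact: cvg_snd.
  have wS0 : 0 < w S 0 * (w S 0 - 0 * (f00 0 / 2)).
    by rewrite mul0r subr0 -expr2 exprn_even_gt0.
  by apply: filterS (cvgr_gt _ cS 0 wS0).
move: P3 => [[A B] /= [FA FB] AB].
have FAB : F _ := @filterI _ F FF _ _ (@filterI _ F FF _ _ FA FB) (@filterI _ F FF _ _ P1 P2).
rewrite FE in FAB.
have [d d0 dP] := near0_args FAB.
exists d => //.
split=> [y x l yd xd ld|y x l yd xd ld|S wS y x l y' x' l' yd xd ld yd' xd' ld'].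
- by have [_ []] := dP y x l yd xd ld.
- by have [_ []] := dP y x l yd xd ld.
- have [[Az _] _] := dP y x l yd xd ld; have [[_ Bz] _] := dP y' x' l' yd' xd' ld'.
  by have := AB (args y x l, args y' x' l') (conj Az Bz) S wS; rewrite /= args_pos0.
Qed.

End Estimates.

(** * Calculus of smooth functions and their 2-jets *)

Section SmoothFunctions.
Variables (R : realType) (n : nat).
Implicit Types f g : 'rV[R]_n -> R.

Lemma smooth_differentiable f x : smooth f -> differentiable f x.
Proof. by move=> /(_ [::]). Qed.

Lemma smooth_partial f j : smooth f -> smooth (partial j f).
Proof. by move=> sf s x; have := sf (rcons s j) x; rewrite foldr_rcons. Qed.

(** [foldr] differentiates in the last index of [s] first, so indices are peeled off at the end. *)
Lemma smooth_of_partial f :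
  (forall x, differentiable f x) -> (forall j, smooth (partial j f)) -> smooth f.
Proof.
move=> df spf s x; elim/last_ind: s => [|s j _]; first exact: df.
by rewrite foldr_rcons; apply: spf.
Qed.

Lemma partial_cst (c : R) j : partial j (cst c : 'rV[R]_n -> R) = cst 0.
Proof. by apply/funext => x; rewrite /partial derive_cst. Qed.

Lemma smooth_cst (c : R) : smooth (cst c : 'rV[R]_n -> R).
Proof.
suff E s : exists c', foldr (@partial R n) (cst c) s = cst c'.
  by move=> s x; have [c' ->] := E s; exact: differentiable_cst.
by elim: s => [|j s [c' /= ->]]; [exists c | exists 0; rewrite partial_cst].
Qed.

Lemma partialD f g j : smooth f -> smooth g ->
  partial j (f + g) = partial j f + partial j g.
Proof.
move=> sf sg; apply/funext => x; rewrite /partial deriveD//.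
  by apply: diff_derivable; exact: smooth_differentiable.
by apply: diff_derivable; exact: smooth_differentiable.
Qed.

Lemma partialZ (c : R) f j : smooth f -> partial j (c *: f) = c *: partial j f.
Proof.
move=> sf; apply/funext => x; rewrite /partial deriveZ//.
by apply: diff_derivable; exact: smooth_differentiable.
Qed.

Lemma smoothD f g : smooth f -> smooth g -> smooth (f + g).
Proof.
move=> sf sg.
(* Being a sum of two smooth functions is stable under [partial], hence suits the induction on
   [s]. *)
suff E s : exists f' g',
    [/\ smooth f', smooth g' & foldr (@partial R n) (f + g) s = f' + g'].
  move=> s x; have [f' [g' [sf' sg' ->]]] := E s.
  by apply: differentiableD; exact: smooth_differentiable.
elim: s => [|j s [f' [g' [sf' sg' /= ->]]]]; first by exists f, g.
exists (partial j f'), (partial j g'); rewrite partialD//.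
by split => //; exact: smooth_partial.
Qed.

Lemma smoothZ (c : R) f : smooth f -> smooth (c *: f).
Proof.
move=> sf.
suff E s : exists2 f', smooth f' & foldr (@partial R n) (c *: f) s = c *: f'.
  move=> s x; have [f' sf' ->] := E s.
  by apply: differentiableZ; exact: smooth_differentiable.
elim: s => [|j s [f' sf' /= ->]]; first by exists f.
by exists (partial j f'); [exact: smooth_partial | rewrite partialZ].
Qed.

(** Coordinates and their squares are the building blocks of the perturbation in the density
    argument. *)
Definition coordinate (a : 'I_n) : 'rV[R]_n -> R := fun x => x 0 a.

Lemma coordinate_linear a : linear (coordinate a).
Proof. by move=> c x y; rewrite /coordinate !mxE. Qed.

HB.instance Definition _ a :=
  GRing.isLinear.Build R 'rV[R]_n R _ (coordinate a) (coordinate_linear a).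

Lemma differentiable_coordinate a x : differentiable (coordinate a) x.
Proof. exact: differentiable_coord. Qed.

Lemma partial_coordinate a j : partial j (coordinate a) = cst (a == j)%:R.
Proof.
apply/funext => x; rewrite /partial deriveE; last exact: differentiable_coordinate.
rewrite diff_lin; first by rewrite /= /coordinate mxE eqxx.
exact: coord_continuous.
Qed.

Lemma smooth_coordinate a : smooth (coordinate a).
Proof.
apply: smooth_of_partial => [x|j]; first exact: differentiable_coordinate.
by rewrite partial_coordinate; exact: smooth_cst.
Qed.

Lemma partial_coordinate_sqr a j :
  partial j (coordinate a * coordinate a) = (2 * (a == j)%:R) *: coordinate a.
Proof.
apply/funext => x; rewrite /partial deriveM.
- rewrite -/(partial j (coordinate a) x) partial_coordinate /GRing.scale/=.
  by rewrite -[RHS]/(2 * (a == j)%:R * coordinate a x) mulrC; ring.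
- by apply: diff_derivable; exact: differentiable_coordinate.
- by apply: diff_derivable; exact: differentiable_coordinate.
Qed.

Lemma smooth_coordinate_sqr a : smooth (coordinate a * coordinate a).
Proof.
apply: smooth_of_partial => [x|j].
  by apply: differentiableM; exact: differentiable_coordinate.
by rewrite partial_coordinate_sqr; apply: smoothZ; exact: smooth_coordinate.
Qed.

Lemma jet2_1E f a : (jet2 f).1 0 a = partial a f 0.
Proof. by rewrite /jet2/= mxE. Qed.

Lemma jet2_2E f a b : (jet2 f).2 a b = partial a (partial b f) 0.
Proof. by rewrite /jet2/= mxE. Qed.

Lemma jet2D f g : smooth f -> smooth g -> jet2 (f + g) = jet2 f + jet2 g.
Proof.
move=> sf sg; transitivity (\row_a partial a f 0 + \row_a partial a g 0,
  \matrix_(a, b) partial a (partial b f) 0 +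
  \matrix_(a, b) partial a (partial b g) 0) => //; congr pair.
  by apply/rowP => a; rewrite mxE (partialD a sf sg) [RHS]mxE ![in RHS]mxE.
apply/matrixP => a b; rewrite mxE (partialD b sf sg).
rewrite (partialD a (smooth_partial b sf) (smooth_partial b sg)).
by rewrite [RHS]mxE [X in _ = X + _]mxE [X in _ = _ + X]mxE.
Qed.

Lemma jet2Z (c : R) f : smooth f -> jet2 (c *: f) = c *: jet2 f.
Proof.
move=> sf; transitivity (c *: \row_a partial a f 0,
  c *: \matrix_(a, b) partial a (partial b f) 0) => //; congr pair.
  by apply/rowP => a; rewrite mxE (partialZ c a sf) [RHS]mxE ![in RHS]mxE.
apply/matrixP => a b; rewrite mxE (partialZ c b sf).
by rewrite (partialZ c a (smooth_partial b sf)) [RHS]mxE ![in RHS]mxE.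
Qed.

End SmoothFunctions.

(** * Nondegenerate jets form an open dense set *)

Section Genericity.
Variables (R : realType) (k : nat).
Local Notation n := (1 + k + 1)%N.

(* The term p.1 0 (pos0 k) vanishes for the jets of elements of V0. *)
Definition nondegenerate_jet (p : 'rV[R]_n * 'M[R]_n) : Prop :=
  p.1 0 (pos0 k) + \sum_i p.1 0 (pos i) != 0 /\ p.2 (pos0 k) (pos0 k) != 0.

Lemma open_nondegenerate : open nondegenerate_jet.
Proof.
have c1 : continuous (fun p : 'rV[R]_n * 'M[R]_n => p.1 0 (pos0 k) + \sum_i p.1 0 (pos i)).
  have c a : continuous (fun p : 'rV[R]_n * 'M[R]_n => p.1 0 a).
    move=> p; apply: (@cvg_comp _ _ _ fst (fun v : 'rV[R]_n => v 0 a)).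
      exact: cvg_fst.
    exact: coord_continuous.
  move=> p; apply: cvgD; first exact: (c _ p).
  by apply: cvg_sumr => i _; exact: (c _ p).
have c2 : continuous (fun p : 'rV[R]_n * 'M[R]_n => p.2 (pos0 k) (pos0 k)).
  move=> p; apply: (@cvg_comp _ _ _ snd (fun v : 'M[R]_n => v (pos0 k) (pos0 k))).
    exact: cvg_snd.
  exact: coord_continuous.
have -> : nondegenerate_jet =
  (fun p : 'rV[R]_n * 'M[R]_n => p.1 0 (pos0 k) + \sum_i p.1 0 (pos i)) @^-1` [set x | x != 0]
  `&` (fun p : 'rV[R]_n * 'M[R]_n => p.2 (pos0 k) (pos0 k)) @^-1` [set x | x != 0] by [].
apply: openI.
  by apply: open_comp => [p _|]; [exact: c1 | exact: open_neq].
by apply: open_comp => [p _|]; [exact: c2 | exact: open_neq].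
Qed.

Lemma nondegenerate_jetE (f : 'rV[R]_n -> R) : nondegenerate_jet (jet2 f) =
  (partial (pos0 k) f 0 + \sum_i partial (pos i) f 0 != 0 /\
   partial (pos0 k) (partial (pos0 k) f) 0 != 0).
Proof.
rewrite /nondegenerate_jet jet2_1E jet2_2E; congr (_ + _ != 0 /\ _).
by apply: eq_bigr => i _; rewrite jet2_1E.
Qed.

Lemma V0D (f g : 'rV[R]_n -> R) : V0 R k f -> V0 R k g -> V0 R k (f + g).
Proof.
move=> [[sf f0] df] [[sg g0] dg]; split; first split.
- exact: smoothD.
- by move=> l; rewrite -[LHS]/(f _ + g _) f0 g0 addr0.
- by rewrite (partialD (pos0 k) sf sg) -[LHS]/(partial _ f 0 + partial _ g 0) df dg addr0.
Qed.

Lemma V0Z (c : R) (f : 'rV[R]_n -> R) : V0 R k f -> V0 R k (c *: f).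
Proof.
move=> [[sf f0] df]; split; first split.
- exact: smoothZ.
- by move=> l; rewrite -[LHS]/(c * f _) f0 mulr0.
- by rewrite (partialZ c (pos0 k) sf) -[LHS]/(c * partial _ f 0) df mulr0.
Qed.

Lemma V0_linear i : V0 R k (coordinate (pos i)).
Proof.
split; first split; first exact: smooth_coordinate.
- by move=> l; rewrite /coordinate args_pos.
- by rewrite partial_coordinate.
Qed.

Lemma V0_square : V0 R k (coordinate (pos0 k) * coordinate (pos0 k)).
Proof.
split; first split; first exact: smooth_coordinate_sqr.
- by move=> l; rewrite -[LHS]/(coordinate _ _ * coordinate _ _) /coordinate args_pos0 mulr0.
- by rewrite partial_coordinate_sqr -[LHS]/(_ * coordinate _ _) /coordinate mxE mulr0.
Qed.

Lemma nondegenerate_dense : (0 < k)%N ->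
  @jet2 R n @` V0 R k `<=` closure ((nondegenerate_jet : set _) `&` (@jet2 R n @` V0 R k)).
Proof.
(* Perturb f by a small multiple of x_1 + x_0^2. *)
have shift2_neq0 (x e : R) : e != - (x / 2) -> x + e * 2 != 0.
  by apply: contra => /eqP E; apply/eqP; lra.
move=> k0 _ [f Vf <-] B Bf.
pose i0 := Ordinal k0.
pose q := coordinate (pos i0) + coordinate (pos0 k) * coordinate (pos0 k) : 'rV[R]_n -> R.
have Vq : V0 R k q by apply: V0D; [exact: V0_linear | exact: V0_square].
have [sf sq] : smooth f /\ smooth q by case: Vf => -[]; case: Vq => -[].
have jE e : jet2 (f + e *: q) = jet2 f + e *: jet2 q.
  by rewrite jet2D ?jet2Z//; exact: smoothZ.
have q1 : partial (pos0 k) q 0 + \sum_i partial (pos i) q 0 = 1.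
  rewrite (Vq.2) add0r (bigD1 i0)//= big1 => [|i ii0].
    rewrite (partialD _ (smooth_coordinate _) (smooth_coordinate_sqr _)).
    rewrite partial_coordinate partial_coordinate_sqr eqxx addr0.
    by rewrite -[LHS]/(1 + _ * coordinate _ _) /coordinate mxE mulr0 addr0.
  rewrite (partialD _ (smooth_coordinate _) (smooth_coordinate_sqr _)).
  rewrite partial_coordinate partial_coordinate_sqr.
  rewrite -[LHS]/((pos i0 == pos i)%:R + _ * coordinate _ _) /coordinate mxE mulr0 addr0.
  by rewrite (inj_eq (@lshift_inj _ _)) (inj_eq (@rshift_inj _ _)) eq_sym (negbTE ii0).
have q2 : partial (pos0 k) (partial (pos0 k) q) 0 = 2.
  rewrite (partialD _ (smooth_coordinate _) (smooth_coordinate_sqr _)).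
  rewrite partial_coordinate partial_coordinate_sqr eqxx mulr1.
  rewrite (partialD _ (smooth_cst _) (smoothZ _ (smooth_coordinate _))) partial_cst.
  rewrite (partialZ _ _ (smooth_coordinate _)) partial_coordinate eqxx.
  by rewrite -[LHS]/(0 + 2 * 1) add0r mulr1.
have cj : jet2 f + e *: jet2 q @[e --> 0^'] --> jet2 f.
  apply: cvg_within_filter.
  rewrite -[jet2 f in X in _ --> X]addr0 -[X in _ + X](scale0r (jet2 q)).
  apply: cvgD; first exact: cvg_cst.
  by apply: cvgZr_tmp; exact: cvg_id.
(* Both nondegeneracy quantities are affine in [e], with slopes 1 and 2 by [q1] and [q2], so each
   rules out a single value of [e]. *)
have N e : e != - (partial (pos0 k) f 0 + \sum_i partial (pos i) f 0) ->
    e != - (partial (pos0 k) (partial (pos0 k) f) 0 / 2) ->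
    nondegenerate_jet (jet2 (f + e *: q)).
  rewrite nondegenerate_jetE.
  have j1 a : partial a (f + e *: q) 0 = partial a f 0 + e * partial a q 0.
    by rewrite (partialD a sf (smoothZ e sq)) (partialZ e a sq).
  have j2 a b : partial a (partial b (f + e *: q)) 0 =
      partial a (partial b f) 0 + e * partial a (partial b q) 0.
    rewrite (partialD b sf (smoothZ e sq)) (partialZ e b sq).
    rewrite (partialD a (smooth_partial b sf) (smoothZ e (smooth_partial b sq))).
    by rewrite (partialZ e a (smooth_partial b sq)).
  move=> e1 e2; split; last first.
    by rewrite j2 q2; exact: shift2_neq0.
  under eq_bigr do rewrite j1.
  rewrite j1 big_split/= addrACA -mulr_sumr -mulrDr q1 mulr1.
  by rewrite addrC addr_eq0.
(* The punctured neighbourhood also avoids [c = 0], the forbidden value when [f] itself is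
   degenerate. *)
have neq c : \forall e \near (0 : R)^', e != c.
  have [->|c0] := eqVneq c 0; first exact: nbhs_dnbhs_neq.
  apply: nbhs_dnbhs; apply: (open_nbhs_nbhs (A := [set e | e != c])).
  by split; [exact: open_neq | rewrite /= eq_sym].
have Bj : \forall e \near (0 : R)^', B (jet2 f + e *: jet2 q) by exact: cj.
have [e [Be [e1 e2]]] := filter_ex (filterI Bj (filterI
  (neq (- (partial (pos0 k) f 0 + \sum_i partial (pos i) f 0)))
  (neq (- (partial (pos0 k) (partial (pos0 k) f) 0 / 2))))).
exists (jet2 (f + e *: q)); split; last by rewrite jE.
by split; [exact: N | exists (f + e *: q) => //; apply: V0D => //; exact: V0Z].
Qed.

End Genericity.

(** * Smallness of branches near lambda = 0 *)

Lemma branch_small (R : realType) (k : nat) (f : 'rV[R]_(1 + k + 1) -> R)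
    (N : network k) (b : branch f N) (d : R) : 0 < d ->
  \forall l \near (0 : R), br_dom b l -> forall c, `|br_fun b l c| < d.
Proof.
move=> d0.
suff H : \forall l \near (0 : R), forall c, br_dom b l -> `|br_fun b l c| < d.
  by apply: filterS H => l H bl c; exact: H.
(* There are finitely many cells, so it suffices to treat one cell at a time. *)
apply: (@filter_forall _ _ (fun c l => br_dom b l -> `|br_fun b l c| < d) (nbhs (0 : R))) => c.
have [r2 r1] := br_regular b c.
(* Continuity at 0 comes from differentiability on a two-sided domain, and from continuity within
   the domain on a one-sided one. *)
have [D2|D1] := br_domain b.
  have D0 : br_dom b 0.
    by case: D2 => l0 l0_gt0 ->; rewrite /= in_itv/= oppr_lt0 l0_gt0.
  have /derivable1_diffP/differentiable_continuous c0 := r2 D2 0%N 0 D0.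
  have {}c0 : br_fun b l c @[l --> (0 : R)] --> br_fun b 0 c by exact: c0.
  rewrite br_origin in c0.
  by apply: (@filterS _ (nbhs (0 : R)) _ _ _ _ (cvgr0_norm_lt _ c0 _ d0)) => l ld _.
have D0 : br_dom b 0.
  by case: D1 => l0 l0_gt0 [] ->; rewrite /= in_itv/= ?oppr_lt0 ?lexx l0_gt0.
have /subspace_continuousP/(_ 0 D0) c0 := (r1 D1).1.
have {}c0 : br_fun b l c @[l --> within (br_dom b) (nbhs (0 : R))] --> br_fun b 0 c.
  by exact: c0.
rewrite br_origin in c0.
exact: (cvgr0_norm_lt _ c0 _ d0).
Qed.

Local Close Scope classical_set_scope.

Lemma product_sign_absurd (R : realDomainType) (p u v : R) :
  p * u < 0 -> p * v < 0 -> u * v < 0 -> False.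
Proof.
move=> pu pv uv; have := nmulr_rgt0 (p * v) pu; rewrite pv.
by rewrite mulrACA -expr2 ltNge mulr_ge0_le0 ?sqr_ge0// ltW.
Qed.

(** * The projection of the split onto [N] and the layers *)

Section Split.
Variables (k : nat) (N L : network k) (m n : nat) (layN : N -> nat) (layL : L -> nat).
Hypotheses (ffN : feed_forward m layN) (ffL : feed_forward n layL).
Variables (c : N) (S : {set L}) (phi : quotient_network (collapse S) -> N).
Hypotheses (c_layer : c \in layer layN 1) (splitL : is_split c phi).

Let pr (d : L) : N := phi (cell_class (collapse S) d).

(** The quotient network evaluates [src] at a representative of the class of [d]; balancedness makes
    the choice immaterial. *)
Lemma projection_src i d : pr (src L i d) = src N i (pr d).
Proof.
rewrite /pr -(split_iso splitL).2; congr phi.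
rewrite /cell_class /= -lock; apply/eqmodP.
apply: (split_balanced splitL); apply/eqmodP.
by rewrite reprK.
Qed.

Lemma projection_inj d e : pr d = pr e -> collapse S d e.
Proof. by move=> /(bij_inj (split_iso splitL).1) /eqmodP. Qed.

(** The source of [d] is in the class of [d], a singleton because [S] lies over the second layer. *)
Lemma src_first_layer i d : pr d \in layer layN 0 -> src L i d = d.
Proof.
move=> d0; have /projection_inj : pr (src L i d) = pr d.
  by rewrite projection_src (ff_first ffN).
rewrite /= /collapse_rel => /orP[/eqP//|/andP[_ dS]].
by move: d0 c_layer; rewrite /pr (split_class splitL dS) !inE => /eqP ->.
Qed.

Lemma src_second_layer i d : pr d \in layer layN 1 -> pr (src L i d) \in layer layN 0.
Proof.
move=> d1; rewrite projection_src; apply: (ff_prev ffN) => //.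
by have := ff_cover ffN (pr d); move: d1; rewrite inE => /eqP ->.
Qed.

Lemma src_third_layer i d : pr d \in layer layN 2 -> pr (src L i d) \in layer layN 1.
Proof.
move=> d2; rewrite projection_src; apply: (ff_prev ffN) => //.
by have := ff_cover ffN (pr d); move: d2; rewrite inE => /eqP ->.
Qed.

(* [i] only witnesses that there is an edge type. *)
Lemma second_layer_lift (i : 'I_k) d : pr d \in layer layN 1 -> d \in layer layL 1.
Proof.
move=> d1; have s0 := src_second_layer i d1; rewrite inE.
(* In layer 0 of [L], [d] would be its own source, although the two project to different layers of
   [N]. In layer [j + 2], the source of [d] would be in layer [j + 1] and its own source in layer
   [j], but these two coincide by [src_first_layer]. *)
case E : (layL d) => [|[|j]] //.
  have : src L i d = d by apply: (ff_first ffL); rewrite inE E.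
  by move=> sd; move: s0 d1; rewrite sd !inE => /eqP ->.
have jn : (j.+1 < n)%N by have := ff_cover ffL d; rewrite E.
have s1 : src L i d \in layer layL j.+1 by apply: (ff_prev ffL) => //; rewrite inE E.
have : src L i (src L i d) \in layer layL j by apply: (ff_prev ffL) (ltnW jn) s1.
rewrite (src_first_layer i s0) => s2; move: s1 s2; rewrite !inE => /eqP ->.
by rewrite eqn_leq ltnn.
Qed.

(** * Equilibria on the split for one fixed lambda *)

Section Equilibrium.
Variables (R : realType) (f : 'rV[R]_(1 + k + 1) -> R) (d l : R) (x : L -> R).
Hypotheses (Vf : V R k f) (ld : `|l| < d) (xd : forall e, `|x e| < d).
Hypothesis x_equilibrium : forall e, vector_field f x l e = 0.

Let f00 := partial (pos0 k) (partial (pos0 k) f).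
Let w (T : {set 'I_k}) z := \sum_(i in T) partial (pos i) f z.

Hypothesis diagonal_bound : forall y x l, `|y| < d -> (forall i, `|x i| < d) ->
  `|l| < d ->
  partial (pos0 k) f (args y x l) + \sum_i partial (pos i) f (args y x l) != 0.
Hypothesis second_order_bound : forall y x l,
  `|y| < d -> (forall i, `|x i| < d) -> `|l| < d -> 0 < f00 0 * f00 (args y x l).
Hypothesis weight_bound : forall T, w T 0 != 0 -> forall y x l y' x' l',
  `|y| < d -> (forall i, `|x i| < d) -> `|l| < d ->
  `|y'| < d -> (forall i, `|x' i| < d) -> `|l'| < d ->
  0 < w T 0 * (w T (args y x l) - y * (f00 (args y' x' l') / 2)).

(** All inputs of such a cell come from the cell itself, which puts its equation on the diagonal. *)
Lemma first_layer_eq0 e : pr e \in layer layN 0 -> x e = 0.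
Proof.
move=> e0; apply: (diagonal_root_eq0 Vf diagonal_bound (xd e) ld).
rewrite -[RHS](x_equilibrium e) /vector_field; congr (f (args _ _ _)).
by apply/funext => i; rewrite src_first_layer.
Qed.

Lemma second_layer_root e : pr e \in layer layN 1 -> f (args (x e) (fun=> 0) l) = 0.
Proof.
move=> e1; rewrite -[RHS](x_equilibrium e) /vector_field; congr (f (args _ _ _)).
by apply/funext => i; rewrite first_layer_eq0// src_second_layer.
Qed.

Lemma second_layer_nonzero_eq e e' : pr e \in layer layN 1 -> pr e' \in layer layN 1 ->
  x e != 0 -> x e' != 0 -> x e = x e'.
Proof.
move=> e1 e1' xe xe'.
apply: (nonzero_root_unique Vf second_order_bound (xd e) (xd e') ld xe xe').
  exact: second_layer_root.
exact: second_layer_root.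
Qed.

(** A nonzero total weight at a third-layer cell is forced to have the sign opposite to
    [f00 0 * x a], so two such weights cannot have opposite signs. The names [a], [a'] leave open
    which of the two split cells has the nonzero value. *)
Lemma half_active_absurd (a a' : L) : S = [set a; a'] -> x a != 0 -> x a' = 0 ->
  (forall I : {set L}, I \subset layer layL 1 :\: S -> exists d' d'',
    [/\ pr d' \in layer layN 2, pr d'' \in layer layN 2 &
      (weight f I d' + weight f [set a] d') *
      (weight f I d'' + weight f [set a] d'') < 0]) -> False.
Proof.
move=> SE xa xa' H.
have aS : a \in S by rewrite SE set21.
have a1 : pr a \in layer layN 1 by rewrite /pr (split_class splitL aS).
pose I : {set L} := [set e in layer layL 1 :\: S | x e != 0].
have [|d1 [d2 [d1l d2l]]] := H I; first by apply/fintype.subsetP => e; rewrite inE => /andP[].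
have sign e : pr e \in layer layN 2 -> weight f I e + weight f [set a] e != 0 ->
    f00 0 * x a * (weight f I e + weight f [set a] e) < 0.
  move=> e2 we.
  pose T : {set 'I_k} := [set i | src L i e \in a |: I].
  (* [I] avoids [S] and hence [a], so the two weights add up without overlap. *)
  have wE : weight f I e + weight f [set a] e = w T 0.
    rewrite /weight /w addrC [RHS](bigID (fun i => src L i e \in [set a])) /=.
    congr (_ + _); apply: eq_bigl => i; rewrite !inE.
      by case: (_ == a); rewrite ?andbT ?andbF.
    by case: (eqVneq (src L i e) a) => [->|_]; rewrite ?aS ?andbF ?andbT.
  rewrite wE in we *.
  apply: (forced_root_sign Vf second_order_bound (weight_bound we) (xd a) (xd e) ld xa).
    exact: second_layer_root.
  rewrite -[RHS](x_equilibrium e) /vector_field; congr (f (args _ _ _)).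
  (* Every source is in the second layer of [L]. In [a |: I] its value is the common nonzero root
     [x a]; otherwise it is [a'] or a cell left out of [I], with value 0. *)
  apply/funext => i; have s1 := src_third_layer i e2.
  have := second_layer_lift i s1; rewrite /T /I !inE => ->.
  rewrite andbT SE !inE.
  case: (eqVneq (src L i e) a) => [->//|_] /=.
  case: (eqVneq (src L i e) a') => [->//|_] /=.
  by case: (eqVneq (x (src L i e)) 0) => [//|xs]; apply: second_layer_nonzero_eq.
move=> W; move: (ltr0_neq0 W); rewrite mulf_eq0 negb_or => /andP[w1 w2].
exact: product_sign_absurd (sign _ d1l w1) (sign _ d2l w2) W.
Qed.

End Equilibrium.
End Split.

Theorem proposition6p6 (R : realType) (k : nat)
    (N : network k) (m : nat) (layN : N -> nat) (ffN : feed_forward m layN) :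
  generic (V0 R k) (fun f =>
    forall (L : network k) (n : nat) (layL : L -> nat),
      feed_forward n layL -> is_lift N L ->
    forall (c : N) (c1 c2 : L)
           (phi : quotient_network (collapse [set c1; c2]) -> N),
      c \in layer layN 1 ->
      c1 \in layer layL 1 -> c2 \in layer layL 1 -> c1 != c2 ->
      is_split c phi ->
      (forall I : {set L}, I \subset layer layL 1 :\: [set c1; c2] ->
        exists d' d'' : L,
          [/\ phi (cell_class (collapse [set c1; c2]) d') \in layer layN 2,
              phi (cell_class (collapse [set c1; c2]) d'') \in layer layN 2,
              (weight f I d' + weight f [set c1] d') *
              (weight f I d'' + weight f [set c1] d'') < 0
            & (weight f I d' + weight f [set c2] d') *
              (weight f I d'' + weight f [set c2] d'') < 0]) ->
    forall b : branch f L, bifurcation_branch b -> lifted_from N b).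
Proof.
have [k0|k0] := posnP k.
  (* Without edges there is no second layer, so the claim is vacuous. *)
  exists (@jet2 R (1 + k + 1) @` V0 R k)%classic; split.
  - by exists setT; [exact: openT | rewrite setTI].
  - exact: subset_closure.
  move=> f _ _ L n layL _ _ c c1 c2 phi cl.
  have m0 : (0 < m)%N by have := ff_cover ffN c; move: cl; rewrite inE => /eqP ->.
  have [z z0] := ff_nonempty ffN (leq0n m).
  by have [i _] := ff_next ffN m0 z0; case: i; rewrite {1}k0.
(* The nondegeneracy conditions mention neither [L] nor the branch, so one open dense set serves all
   lifts. *)
exists (@nondegenerate_jet R k `&` (@jet2 R (1 + k + 1) @` V0 R k))%classic; split.
- by exists (@nondegenerate_jet R k) => //; exact: open_nondegenerate.
- exact: nondegenerate_dense.
move=> f [Vf f0] [+ _]; rewrite nondegenerate_jetE => -[T0 A0].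
move=> L n layL ffL _ c c1 c2 phi cl c1l c2l c12 split H b _.
have [d d_gt0 [b1 b2 b3]] := near_uniform_bounds Vf T0 A0.
(* The coloring merging [c1] and [c2] works for every branch, so only the values of these two cells
   need comparing. *)
exists (collapse [set c1; c2]); split; first exact: split_balanced split.
  by exists phi; exact: split_iso split.
have nd := @nbhs0_lt _ R _ d_gt0.
near=> l => bl.
have ld : `|l| < d by near: l; exact: nd.
have xd : forall e, `|br_fun b l e| < d by move: bl; near: l; exact: branch_small.
have eqv := br_equilibrium bl.
suff E : br_fun b l c1 = br_fun b l c2.
  move=> e e' /=; rewrite /collapse_rel => /orP[/eqP->//|].
  by rewrite !inE => /andP[] /orP[] /eqP -> /orP[] /eqP ->.
have abs := half_active_absurd ffN ffL cl split Vf ld xd eqv b1 b2 b3.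
have [x1|x1] := eqVneq (br_fun b l c1) 0; have [x2|x2] := eqVneq (br_fun b l c2) 0.
- by rewrite x1 x2.
(* Here only [c2] has a nonzero value: the pair is swapped and the second inequality applies. *)
- exfalso; apply: (abs c2 c1) => //; first by rewrite finset.setUC.
  by move=> I IS; have [d1 [d2 [? ? _ ?]]] := H I IS; exists d1, d2.
- exfalso; apply: (abs c1 c2) => //.
  by move=> I IS; have [d1 [d2 [? ? ? _]]] := H I IS; exists d1, d2.
(* Both values are small nonzero roots of the same equation, hence equal. *)
- apply: (second_layer_nonzero_eq ffN cl split Vf ld xd eqv b1 b2) => //;
    by rewrite (split_class split) ?set21 ?set22.
Unshelve. all: by end_near. Qed.
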